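(* Assume that $M$ is a locally right Garside monoid satisfying Condition $(C_3^+)$, with atom set $S$, and $\boldsymbol{M}$ is a dense atomic $n$-covering of $M$ based on $\boldsymbol{g}=(g_\alpha)_{\alpha\in\{1,2\}^n}$. Then each element $x$ of $M$ admits a unique $\boldsymbol{M}$-normal representative, namely $g_{\alpha_\ell}\cdots g_{\alpha_1}$, where $\alpha_\ell,\ldots,\alpha_1$ are inductively determined from $x^{(0)}=x$ and $\alpha_0=1^n$ by $$\alpha_k=\alpha_{k-1}^{[m]}\quad\text{and}\quad x^{(k)}=x^{(k-1)}g_{\alpha_k}^{-1},$$ where $m$ is maximal such that $g_{\alpha_{k-1}^{[m]}}$ is a right divisor of $x^{(k-1)}$ (the induction stopping when $x^{(\ell)}=1$). Moreover, $g_{\alpha_\ell}\cdots g_{\alpha_1}$ is the word obtained from the $\boldsymbol{M}$-decomposition of $x$ by concatenating the entries and possibly deleting the final $1$.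
   Context: For a monoid $M$ and $x,y\in M$: $y$ is a right divisor of $x$, and $x$ is a left multiple of $y$, if $x=zy$ for some $z\in M$; $y\prec x$ means $x=zy$ for some $z\neq1$. $\mathrm{Div}_R(x)$ is the set of right divisors of $x$. A left lcm of $x,y$ is a common left multiple that is a right divisor of every common left multiple. $M$ is locally right Garside if: $(C_1)$ $M$ is right cancellative; $(C_2)$ any two elements that admit a common left multiple admit a left lcm; $(C_3)$ for every $x$ there is no infinite chain $x_1\prec x_2\prec\cdots$ in $\mathrm{Div}_R(x)$. If $y$ is a right divisor of $x$, $xy^{-1}$ denotes the unique $z$ with $x=zy$. Condition $(C_3^+)$: there exists $\lambda:M\to\mathbb{N}$ such that $y\ne1$ implies $\lambda(xy)\ge\lambda(x)+\lambda(y)>\lambda(x)$. An atom is an element $g\neq1$ such that $g=xy$ implies $x=1$ or $y=1$. A submonoid $M_1$ of $M$ is closed if every left lcm (in $M$) of elements of $M_1$ and every left divisor (in $M$) of an element of $M_1$ belong to $M_1$ (it is then itself locally right Garside). $x\perp A$ means that no non-trivial element of $A$ is a right divisor of $x$. $(M_2,M_1)$ is a covering of $M$ if $M_2,M_1$ are closed submonoids of $M$ whose union generates $M$. For an integer $r$, $[r]=1$ if $r$ is odd, $2$ if $r$ is even. The $(M_2,M_1)$-decomposition of $x\neq1$ is the unique sequence $(x_p,\ldots,x_1)$ with $x=x_p\cdots x_1$, $x_p\neq1$, and, for $1\le r\le p$, $x_r\in M_{[r]}$ and $x_p\cdots x_{r+1}\perp M_{[r]}$; the decomposition of $1$ is $(1)$.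 An $n$-covering $\boldsymbol{M}$ of $M$ is a family of monoids $M_\alpha$ indexed by the words $\alpha$ over $\{1,2\}$ of length at most $n$ (binary addresses), with $M_\varnothing=M$ and such that, for each $\alpha$ of length $<n$, $(M_{\alpha2},M_{\alpha1})$ is a covering of $M_\alpha$; for $n\ge1$, $\boldsymbol{M}_k$ denotes the $(n-1)$-covering $(M_{k\alpha})_\alpha$ of $M_k$. It is atomic, based on a family $(g_\alpha)_{\alpha\in\{1,2\}^n}$ of atoms of $M$, if $M_\alpha$ is the submonoid generated by $g_\alpha$ for each $\alpha$ of length $n$. It is dense if, for each binary address $\beta$ of length $m$ with $0\le m<n$, $M_\beta$ is generated by $M_{\beta1}\cup M_{\beta21^{n-m-1}}$, and also by $M_{\beta2}\cup M_{\beta1^{n-m}}$. The $\boldsymbol{M}$-decomposition is $D_{\boldsymbol{M}}(x)=x$ for $n=0$ and $D_{\boldsymbol{M}}(x)=(D_{\boldsymbol{M}_{[p]}}(x_p),\ldots,D_{\boldsymbol{M}_1}(x_1))$ for $n\ge1$, where $(x_p,\ldots,x_1)$ is the $(M_2,M_1)$-decomposition of $x$; in the atomic case its innermost entries are powers $g_\alpha^{e}$, $e\ge0$, each read as the word consisting of $e$ letters $g_\alpha$. For a binary $n$-address $\alpha=d_1\ldots d_n$ and $0\le m\le n$, the binary $m$-successor $\alpha^{[m]}$ keeps the first $m$ digits, exchanges $1$ and $2$ in the $(m+1)$st digit (if $m<n$), and replaces all subsequent digits by $1$; $\alpha^{[n]}=\alpha$. For a word $w$ on $S$, $\overline{w}$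 is the element of $M$ it represents and $w(k)$ is its $k$th letter from the right. A length $\ell$ word $w$ on $S$ is $\boldsymbol{M}$-normal if there exist binary $n$-addresses $\alpha_\ell,\ldots,\alpha_0$ with $\alpha_0=1^n$ such that, for each $k$ with $1\le k\le\ell$, $w(k)=g_{\alpha_k}$, where $\alpha_k$ is the maximal successor of $\alpha_{k-1}$ (i.e., is $\alpha_{k-1}^{[m]}$ with maximal $m$) for which $g_{\alpha_k}$ is a right divisor of $\overline{w(\ell)\ldots w(k)}$. *)

(* Defs.v *)
From mathcomp Require Import all_boot.
From mathcomp Require Import classical_sets.

Set Implicit Arguments.
Unset Strict Implicit.
Unset Printing Implicit Defensive.

Local Open Scope classical_set_scope.
Local Open Scope group_scope.

(* Submonoids of M are sets [N : set M]. Divisibility is taken inside an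
   explicit submonoid N, because each covering in the iteration is a covering
   of the monoid M_alpha rather than of M; N = setT gives M itself. *)
Section Divisibility.
Variable M : monoidType.
Implicit Types (N A P : set M) (x y z : M).

Definition submonoid N := N 1 /\ forall x y, N x -> N y -> N (x * y).

Definition generated A : set M := smallest submonoid A.

Definition rdivides N y x := N y /\ exists2 z, N z & x = z * y.

Definition ldivides N z x := N z /\ exists2 y, N y & x = z * y.

(* y \prec x *)
Definition prec N y x := N y /\ exists z, [/\ N z, z <> 1 & x = z * y].

Definition left_lcm N x y z :=
  [/\ rdivides N x z, rdivides N y z &
      forall z', rdivides N x z' -> rdivides N y z' -> rdivides N z z'].

Definition perp N x A := forall y, A y -> rdivides N y x -> y = 1.

Definition closed_submonoid N P :=
  [/\ submonoid P, P `<=` N,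
      forall x y z, P x -> P y -> left_lcm N x y z -> P z &
      forall x z, P x -> ldivides N z x -> P z].

Definition covering N M2 M1 :=
  [/\ closed_submonoid N M2, closed_submonoid N M1 &
      generated (M2 `|` M1) = N].

Definition atom x := x <> 1 /\ forall y z, x = y * z -> y = 1 \/ z = 1.

End Divisibility.

Record locally_right_Garside (M : monoidType) : Prop := {
  cond_C1 : forall x y z : M, x * z = y * z -> x = y;
  cond_C2 : forall x y : M,
    (exists z, rdivides setT x z /\ rdivides setT y z) ->
    exists z, left_lcm setT x y z;
  cond_C3 : forall x : M,
    ~ exists u : nat -> M,
        forall i, rdivides setT (u i) x /\ prec setT (u i) (u i.+1) }.

Definition cond_C3plus (M : monoidType) :=
  exists lambda : M -> nat, forall x y : M, y <> 1 ->
    (lambda x + lambda y <= lambda (x * y)%g)%N /\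
    (lambda x < lambda x + lambda y)%N.

(* Finite sequences (x_p, ..., x_1) and words are stored in written order, but
   are numbered from the right: [entry x0 s r] is x_r, for 1 <= r <= size s. *)
Definition entry (T : Type) (x0 : T) (s : seq T) (r : nat) : T :=
  nth x0 s (size s - r).

Definition word_prod (M : monoidType) (w : seq M) : M :=
  \big[*%g/1]_(y <- w) y.

(* Binary addresses are lists of booleans, the digit 1 being [false] and the
   digit 2 being [true]. Families indexed by addresses are total functions on
   [seq bool], of which only the values at addresses of the relevant lengths
   are ever used. *)
Definition d1 : bool := false.
Definition d2 : bool := true.

(* [r] *)
Definition parity_digit (r : nat) : bool := if odd r then d1 else d2.

(* The m-successor a^[m], for m <= size a *)
Definition successor (m : nat) (a : seq bool) : seq bool :=
  take m a ++
  (if drop m a is d :: b then ~~ d :: nseq (size b) d1 else [::]).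

Section Coverings.
Variable M : monoidType.
Implicit Types (F : seq bool -> set M) (g : seq bool -> M) (x : M).

Definition n_covering (n : nat) F :=
  F [::] = setT /\
  forall a, (size a < n)%N -> covering (F a) (F (rcons a d2)) (F (rcons a d1)).

Definition atomic_covering (n : nat) F g :=
  forall a, size a = n -> atom (g a) /\ F a = generated [set g a].

Definition dense_covering (n : nat) F :=
  forall b, (size b < n)%N ->
    F b = generated (F (rcons b d1) `|`
                     F (rcons b d2 ++ nseq (n - size b - 1) d1)) /\
    F b = generated (F (rcons b d2) `|` F (b ++ nseq (n - size b) d1)).

(* [s] is the (M2, M1)-decomposition of [x] in the monoid [N] *)
Definition decomposition (N M2 M1 : set M) x (s : seq M) :=
  (x = 1 /\ s = [:: 1]) \/
  [/\ x <> 1, x = word_prod s, entry 1 s (size s) <> 1 &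
      forall r, (1 <= r <= size s)%N ->
        let Mr := if parity_digit r then M2 else M1 in
        Mr (entry 1 s r) /\ perp N (word_prod (take (size s - r) s)) Mr].

(* Depth n nested sequences of elements of M *)
Fixpoint nested (n : nat) : Type :=
  if n is n'.+1 then seq (nested n') else M.

Definition nested0 (n : nat) : nested n :=
  match n with 0 => 1 | _.+1 => [::] end.

(* [t] is D_M(x); the covering M_k is the family [fun a => F (k :: a)]. *)
Fixpoint M_decomposition (n : nat) F x : nested n -> Prop :=
  match n with
  | 0 => fun t => t = x
  | n'.+1 => fun t => exists s : seq M,
      [/\ decomposition (F [::]) (F [:: d2]) (F [:: d1]) x s,
          size t = size s &
          forall r, (1 <= r <= size s)%N ->
            @M_decomposition n' (fun a => F (parity_digit r :: a))
              (entry 1 s r) (entry (nested0 n') t r)]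
  end.

(* The innermost entries of a nested sequence, in written order, each with its
   n-address; [b] is the address of the nested sequence itself. *)
Fixpoint addressed_entries (n : nat) (b : seq bool) :
    nested n -> seq (seq bool * M) :=
  match n with
  | 0 => fun x => [:: (b, x)]
  | n'.+1 => fun t =>
      flatten [seq @addressed_entries n' (rcons b (parity_digit r))
                     (entry (nested0 n') t r)
              | r <- rev (iota 1 (size t))]
  end.

(* [w] is obtained by concatenating the entries, a nontrivial entry g_a^e being
   read as the word of length e > 0 in the letter g_a, after deletion of the
   final entry if it is 1. In particular no other entry is 1. *)
Definition concatenates_to g (s : seq (seq bool * M)) (w : seq M) :=
  exists es : seq (seq bool * nat),
    let powers := [seq (p.1, g p.1 ^+ p.2) | p <- es] in
    [/\ all (fun p => 0 < p.2)%N es,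
        s = powers \/ (exists a, s = rcons powers (a, 1)) &
        w = flatten [seq nseq p.2 (g p.1) | p <- es]].

(* [b] is the maximal successor of [a] such that g_b is a right divisor of x *)
Definition maximal_successor (n : nat) g x (a b : seq bool) :=
  exists m, [/\ (m <= n)%N, b = successor m a, rdivides setT (g b) x &
    forall m', (m' <= n)%N -> rdivides setT (g (successor m' a)) x ->
      (m' <= m)%N].

(* For a = (alpha_l, ..., alpha_1), this is alpha_k if k > 0, and 1^n if k = 0 *)
Definition address_at (n : nat) (a : seq (seq bool)) (k : nat) : seq bool :=
  if k is 0 then nseq n d1 else entry [::] a k.

Definition normal_word (n : nat) g (w : seq M) :=
  (forall s, s \in w -> atom s) /\
  exists a : seq (seq bool),
    [/\ size a = size w, all (fun b => size b == n) a &
        forall k, (1 <= k <= size w)%N ->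
          entry 1 w k = g (address_at n a k) /\
          maximal_successor n g (word_prod (take (size w - k).+1 w))
            (address_at n a k.-1) (address_at n a k)].

(* [a] is the sequence (alpha_l, ..., alpha_1) produced from x by the greedy
   right division; [xs k] is x^(k). *)
Definition greedy_addresses (n : nat) g x (a : seq (seq bool)) :=
  exists xs : nat -> M,
    [/\ xs 0%N = x, xs (size a) = 1 &
        forall k, (1 <= k <= size a)%N ->
          [/\ xs k.-1 <> 1,
              maximal_successor n g (xs k.-1)
                (address_at n a k.-1) (address_at n a k) &
              xs k.-1 = xs k * g (address_at n a k)]].

End Coverings.

(* Main.v *)
(* The key fact: if z has no nontrivial right divisor in a closed submonoid P
   and y lies in P, then an element of P right-divides z * y exactly when it
   right-divides y. Hence, while the greedy division works at an address inside
   M_[r], it sees only the current entry x_r of the (M_2, M_1)-decomposition, and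
   follows the greedy division of x_r relative to the covering of M_[r]. Once
   x_r is exhausted, the remainder z is divisible by no generator of M_[r], so
   the division jumps to the 0-successor, whose address is [r+1] followed by
   digits 1. Density says that this generator divides z as soon as z <> 1:
   M is generated by M_[r] and by the powers of this generator. It also shows
   that the division of x_{r+1} starts at the first address of its covering, so
   that no entry except the last one can be 1. An induction on n concludes. *)
Require Import Defs.
From mathcomp Require Import all_boot.
From mathcomp Require Import boolp classical_sets.

Set Implicit Arguments.
Unset Strict Implicit.
Unset Printing Implicit Defensive.

Section GarsideMonoid.

Local Open Scope classical_set_scope.
Local Open Scope group_scope.

Variables (M : monoidType) (lam : M -> nat).
Hypothesis right_cancel : forall x y z : M, x * z = y * z -> x = y.
Hypothesis lam_superadditive : forall x y : M, y <> 1 ->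
  (lam x + lam y <= lam (x * y)%g)%N /\ (lam x < lam x + lam y)%N.

Implicit Types (N A B P Q : set M) (x y z u v : M).

(** * Trivial units, closed submonoids and the splitting off of a tail *)

Lemma lam_gt0 y : y <> 1 -> (0 < lam y)%N.
Proof. by move=> /(lam_superadditive 1)[_]; rewrite -{1}[lam 1]addn0 ltn_add2l. Qed.

(** If [y] is nontrivial, superadditivity at [1 * y] forces [lam 1 = 0]; then [x * y = 1] would give
    [lam y = 0]. *)
Lemma mulg_eq1_r x y : x * y = 1 -> y = 1.
Proof.
move=> xy1; apply: contrapT => yn1.
have [+ _] := lam_superadditive 1 yn1; rewrite mul1g -[leqRHS]add0n leq_add2r leqn0.
have [+ _] := lam_superadditive x yn1; rewrite xy1 => /[swap] /eqP->.
by rewrite leqn0 addn_eq0 => /andP[_ /eqP y0]; have := lam_gt0 yn1; rewrite y0.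
Qed.

Lemma mulg_eq1_l x y : x * y = 1 -> x = 1.
Proof. by move=> xy1; move: (xy1); rewrite (mulg_eq1_r xy1) mulg1. Qed.

Lemma lam_ltMl x y : y <> 1 -> (lam x < lam (x * y)%g)%N.
Proof. by move=> yn1; have [h1 h2] := lam_superadditive x yn1; apply: leq_trans h1. Qed.

(* A submonoid that is closed in a closed submonoid of M need not contain every
   left divisor in M of its elements, since right divisors may leave it; only
   stability under right quotients passes down the covering, and it suffices to
   compare divisibility in N and in M. *)
Record relative_Garside N : Prop := {
  rel_submonoid : submonoid N;
  rel_quotient : forall x y, N (x * y) -> N y -> N x;
  rel_lcm : forall x y z, rdivides N x z -> rdivides N y z ->
    exists z', left_lcm N x y z' }.

Lemma rdividesT N x y : relative_Garside N -> N x -> N y ->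
  rdivides setT y x <-> rdivides N y x.
Proof.
move=> gN Nx Ny; split=> [[_ [z _ xE]]|[_ [z _ xE]]]; last by split=> //; exists z.
by split=> //; exists z => //; apply: rel_quotient gN _ _ _ Ny; rewrite -xE.
Qed.

(** If [x * y] and [y] lie in [P], then [x] lies in [N] and is a left divisor of [x * y] there,
    hence lies in [P]. So when a left lcm is computed in [N], it belongs to [P] together with its
    cofactors. *)
Lemma closed_relative_Garside N P :
  relative_Garside N -> closed_submonoid N P -> relative_Garside P.
Proof.
move=> gN [[P1 PM] PN Plcm Pdiv].
have Pquo x y : P (x * y) -> P y -> P x.
  move=> Pxy Py; apply: (Pdiv _ _ Pxy); split; last by exists y => //; exact: PN.
  exact: rel_quotient gN _ _ (PN _ Pxy) (PN _ Py).
have PN' a b : rdivides P a b -> rdivides N a b.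
  by move=> [Pa [c Pc bE]]; split; [exact: PN | exists c => //; exact: PN].
split=> // x y z xz yz; have [w lw] := rel_lcm gN (PN' _ _ xz) (PN' _ _ yz).
have Pw := Plcm _ _ _ xz.1 yz.1 lw.
have Pdivides a b : P a -> P b -> rdivides N a b -> rdivides P a b.
  move=> Pa Pb [_ [c _ bE]]; split=> //; exists c => //.
  by apply: Pquo Pa; rewrite -bE.
case: lw => xw yw wmin; exists w; split.
- exact: Pdivides xz.1 Pw xw.
- exact: Pdivides yz.1 Pw yw.
move=> t xt yt; apply: Pdivides => //; last exact: wmin (PN' _ _ xt) (PN' _ _ yt).
by case: xt => Px [c Pc ->]; exact: PM.
Qed.

Lemma perp1 N P : perp N 1 P.
Proof. by move=> y _ [_ [z _ /esym/mulg_eq1_r]]. Qed.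

(** The left lcm [w] of [u] and [y] lies in [P] and right-divides [x * y]. Writing [w = b * y] with
    [b] in [P], cancellation makes [b] a right divisor of [x], so [b = 1] and [w = y]. *)
Lemma perp_rdivides N P x y u : relative_Garside N -> closed_submonoid N P ->
  N x -> P y -> perp N x P -> P u -> rdivides setT u (x * y) ->
  rdivides setT u y.
Proof.
move=> gN cP Nx Py xP Pu uxy; have gP := closed_relative_Garside gN cP.
case: (cP) => _ PN Plcm _.
have [N1 NM] := rel_submonoid gN.
have uN : rdivides N u (x * y).
  by apply/rdividesT => //; [apply: NM => //|]; exact: PN.
have yN : rdivides N y (x * y) by split; [exact: PN | exists x].
have [w lw] := rel_lcm gN uN yN; have Pw := Plcm _ _ _ Pu Py lw.
case: lw => [[_ [a Na wE]] [_ [b Nb wE']] wmin].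
have [_ [c Nc xyE]] := wmin _ uN yN.
have xE : x = c * b by apply: (@right_cancel _ _ y); rewrite -mulgA -wE'.
have b1 : b = 1.
  have Pb : P b by apply: (rel_quotient gP (y := y)) => //; rewrite -wE'.
  by apply: xP => //; split; [exact: PN | exists c].
by split=> //; exists a => //; rewrite -wE wE' b1 mul1g.
Qed.

(** The elements of [N] that are trivial or have a nontrivial right divisor in one of the generating
    sets form a submonoid [K], which therefore is all of [N]. *)
Lemma perp_generated N A B x : submonoid N -> N = generated (A `|` B) -> N x ->
  perp N x A -> perp N x B -> x = 1.
Proof.
move=> [N1 NM] NE Nx xA xB.
pose K := [set u | N u /\ (u = 1 \/
  exists2 y, (A `|` B) y & y <> 1 /\ rdivides N y u)].
have ABN : A `|` B `<=` N by rewrite NE; exact: sub_gen_smallest.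
have NK : N `<=` K.
  rewrite [X in X `<=` _]NE; apply: smallest_sub.
    split; first by split=> //; left.
    move=> u v [Nu uK] [Nv vK]; split; first exact: NM.
    case: vK => [->|[y ABy [yn1 [Ny [z Nz vE]]]]]; first by rewrite mulg1.
    right; exists y => //; split=> //; split=> //.
    by exists (u * z); [exact: NM | rewrite vE mulgA].
  move=> y ABy; split; first exact: ABN.
  have [->|/eqP yn1] := eqVneq y 1; [by left | right].
  exists y => //; split=> //; split; first exact: ABN.
  by exists 1; rewrite ?mul1g.
by have [_ [//|[y [/xA|/xB] yx [yn1 /yx]]]] := NK _ Nx.
Qed.

Lemma generated1 x y : generated [set x] y -> exists e, y = x ^+ e.
Proof.
apply: (@smallest_sub _ _ _ [set y | exists e, y = x ^+ e]).
  split; first by exists 0%N.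
  by move=> _ _ [e1 ->] [e2 ->]; exists (e1 + e2)%N; rewrite expgnDr.
by move=> _ ->; exists 1%N.
Qed.

(** If [g] did not divide [x], no positive power of [g] would either, and [x] would be perpendicular
    to both generating sets. *)
Lemma generator_rdivides N A g x : relative_Garside N ->
  N = generated (A `|` generated [set g]) -> N x -> perp N x A -> x <> 1 ->
  rdivides setT g x.
Proof.
move=> gN NE Nx xA xn1; apply: contrapT => gx.
have sN := rel_submonoid gN; apply: xn1; apply: perp_generated sN NE Nx xA _.
move=> _ /generated1[[//|e] ->] [_ [z _ xE]]; exfalso; apply: gx.
by split=> //; exists (z * g ^+ e) => //; rewrite xE expgSr mulgA.
Qed.

(** Nontrivial right divisors in [P] are split off one after the other; [lam] of the remaining left
    factor drops strictly, so the process stops. *)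
Lemma tail_exists N P x : relative_Garside N -> closed_submonoid N P -> N x ->
  exists y z, [/\ P y, N z, x = z * y & perp N z P].
Proof.
move=> gN cP; have [k] := ubnP (lam x); elim: k x => // k IH x ltx Nx.
case: (cP) => [[P1 PM]] PN _ _.
have [xP|] := pselect (perp N x P).
  by exists 1, x; rewrite mulg1.
move=> /existsNP[u /not_implyP[Pu /not_implyP[[_ [v Nv xE]] un1]]].
have [|//|y [z [Py Nz vE zP]]] := IH v.
  by rewrite ltnS in ltx; apply: leq_trans ltx; rewrite xE; exact: lam_ltMl.
by exists (y * u), z; split=> //; [exact: PM | rewrite xE vE mulgA].
Qed.

(** By [perp_rdivides] used in both directions, [y] and [y'] right-divide each other, and mutually
    inverse cofactors are trivial. *)
Lemma tail_unique N P y y' z z' :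
  relative_Garside N -> closed_submonoid N P ->
  P y -> N z -> perp N z P -> P y' -> N z' -> perp N z' P ->
  z * y = z' * y' -> y = y' /\ z = z'.
Proof.
move=> gN cP Py Nz zP Py' Nz' zP' zyE.
have [_ [a _ yE]] : rdivides setT y' y.
  by apply: perp_rdivides gN cP Nz Py zP Py' _; split=> //; exists z'.
have [_ [b _ yE']] : rdivides setT y y'.
  by apply: perp_rdivides gN cP Nz' Py' zP' Py _; split=> //; exists z.
have ab1 : a * b = 1.
  by apply: (@right_cancel _ _ y); rewrite mul1g -mulgA -yE' -yE.
have yy : y = y' by rewrite yE (mulg_eq1_l ab1) mul1g.
by split=> //; apply: (@right_cancel _ _ y); rewrite zyE yy.
Qed.

(** * Greedy division as a run through addresses *)

Section Greedy.

Variables (n : nat) (g : seq bool -> M).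
Implicit Types (a b : seq bool) (L : seq (seq bool)).

(* Addresses are listed in the order in which the greedy division produces
   them, that is, from right to left in the word. *)
Fixpoint greedy_run x a L z : Prop :=
  if L is b :: L' then maximal_successor n g x a b /\
    exists2 x', x = x' * g b & greedy_run x' b L' z
  else x = z.

Lemma greedy_run_cat x a L1 y L2 z :
  greedy_run x a L1 y -> greedy_run y (last a L1) L2 z ->
  greedy_run x a (L1 ++ L2) z.
Proof.
elim: L1 x a => [|b L1 IH] x a /=; first by move=> ->.
by move=> [xb [x' xE run1]] run2; split=> //; exists x' => //; exact: IH.
Qed.

Lemma size_successor m a : size (successor m a) = size a.
Proof.
rewrite size_cat -[in RHS](cat_take_drop m a) size_cat.
by case: (drop m a) => //= d b; rewrite size_nseq.
Qed.

Lemma size_maximal_successor x a b : maximal_successor n g x a b -> size b = size a.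
Proof. by move=> [m [_ -> _ _]]; exact: size_successor. Qed.

Lemma maximal_successor_unique x a b c :
  maximal_successor n g x a b -> maximal_successor n g x a c -> b = c.
Proof.
move=> [m [mn -> mx mmax]] [p [pn -> px pmax]].
by rewrite (@anti_leq m p) // mmax ?pmax.
Qed.

Lemma greedy_run_size x a L z : greedy_run x a L z ->
  all (fun b => size b == size a) L.
Proof.
elim: L x a => //= b L IH x a [/size_maximal_successor eq_ab [x' _ /IH]].
by rewrite eq_ab eqxx.
Qed.

Hypothesis g_neq1 : forall a, size a = n -> g a <> 1.

Lemma greedy_run_unique x a L1 L2 : size a = n ->
  greedy_run x a L1 1 -> greedy_run x a L2 1 -> L1 = L2.
Proof.
(* A run that has reached [1] cannot go on, since its next letter would be a nontrivial right
   divisor of [1]. *)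
have stop y b c L : size b = n -> y = 1 -> ~ greedy_run y b (c :: L) 1.
  move=> bn -> [/size_maximal_successor cb [z /esym/mulg_eq1_r z1 _]].
  by apply: (@g_neq1 c) z1; rewrite cb.
elim: L1 x a L2 => [|b L1 IH] x a [|c L2] // an; first by move=> x1 /(stop _ _ _ _ an x1).
  by move=> /[swap] x1 /(stop _ _ _ _ an x1).
move=> [xb [x' xE run1]] [xc [y' yE run2]].
have bc := maximal_successor_unique xb xc; rewrite -{c}bc in xc yE run2 *.
congr (_ :: _); apply: (IH x' b) run1 _; first by rewrite (size_maximal_successor xb).
by rewrite (@right_cancel x' y' (g b)) // -xE.
Qed.

End Greedy.

Lemma maximal_successor_neq1 n g x a b : g b <> 1 ->
  maximal_successor n g x a b -> x <> 1.
Proof. by move=> gb [m [_ _ [_ [z _ ->]] _]] /mulg_eq1_r. Qed.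

(** * Dense atomic coverings of a submonoid *)

(** The root [F [::]] may be a proper submonoid of [M], so that these conditions pass to the
    covering [fun a => F (d :: a)] in an induction on [n]. *)
Record relative_dense_covering n (F : seq bool -> set M) (g : seq bool -> M) :
    Prop := {
  rdc_Garside : relative_Garside (F [::]);
  rdc_covering : forall a, (size a < n)%N ->
    covering (F a) (F (rcons a d2)) (F (rcons a d1));
  rdc_atomic : atomic_covering n F g;
  rdc_dense : dense_covering n F }.

Section Covering.

Variables (n : nat) (F : seq bool -> set M) (g : seq bool -> M).
Hypothesis F_rdc : relative_dense_covering n.+1 F g.
Implicit Types (a b : seq bool) (d : bool).

Lemma rdc_closed d : closed_submonoid (F [::]) (F [:: d]).
Proof. by have [] := rdc_covering F_rdc (a := [::]) (ltn0Sn n); case: d. Qed.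

Lemma rdc_sub d :
  relative_dense_covering n (fun a => F (d :: a)) (fun a => g (d :: a)).
Proof.
split.
- exact: closed_relative_Garside (rdc_Garside F_rdc) (rdc_closed d).
- by move=> a an; exact: (rdc_covering F_rdc (a := d :: a)).
- by move=> a an; apply: (rdc_atomic F_rdc); rewrite /= an.
- by move=> a an; exact: (rdc_dense F_rdc (b := d :: a)).
Qed.

Lemma rdc_perp_rdivides d x : F [::] x -> perp (F [::]) x (F [:: d]) -> x <> 1 ->
  rdivides setT (g (~~ d :: nseq n d1)) x.
Proof.
(* Density at the empty address: [E1] settles [d = d1] and [E2] settles [d = d2]. *)
move=> Nx xd; have [E1 E2] := rdc_dense F_rdc (b := [::]) (ltn0Sn n).
rewrite /= subn0 subn1 /= in E1 E2.
apply: (generator_rdivides (rdc_Garside F_rdc) _ Nx xd).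
have size1 c : size (c :: nseq n d1) = n.+1 by rewrite /= size_nseq.
by case: d {xd} => /=; rewrite -(rdc_atomic F_rdc (size1 _)).2.
Qed.

End Covering.

Lemma rdc_generator n F g a : relative_dense_covering n F g -> size a = n ->
  F [::] (g a).
Proof.
elim: n F g a => [|n IH] F g a rF.
  case: a => // _; rewrite (rdc_atomic rF (erefl : size [::] = 0%N)).2.
  exact: sub_gen_smallest.
case: a => // d a [an]; have [_ FN _ _] := rdc_closed rF d.
exact/FN/(IH _ _ _ (rdc_sub rF d)).
Qed.

Lemma rdc_generator_neq1 n F g a : relative_dense_covering n F g -> size a = n ->
  g a <> 1.
Proof. by move=> rF /(rdc_atomic rF)[[]]. Qed.

(** * Greedy steps within one factor and from one factor to the other *)

Section Steps.

Variables (n : nat) (F : seq bool -> set M) (g : seq bool -> M).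
Hypothesis F_rdc : relative_dense_covering n.+1 F g.
Implicit Types (a b : seq bool) (d : bool).

(** Prefixing [d] turns [m]-successors into [m.+1]-successors, and by [perp_rdivides] the generators
    at addresses starting with [d] divide [z * y] only if they divide [y]. The additional
    [0]-successor has the lowest priority. *)
Lemma maximal_successor_lift d y z a b : F [:: d] y -> F [::] z ->
  perp (F [::]) z (F [:: d]) -> size a = n ->
  maximal_successor n (fun a => g (d :: a)) y a b ->
  maximal_successor n.+1 g (z * y) (d :: a) (d :: b).
Proof.
move=> Py Nz zd an [m [mn -> [_ [u _ yE]] mmax]]; exists m.+1; split=> //.
  by split=> //; exists (z * u) => //; rewrite yE mulgA.
case=> // m' m'n gx; apply: mmax => //.
apply: perp_rdivides (rdc_Garside F_rdc) (rdc_closed F_rdc d) Nz Py zd _ gx.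
by apply: (rdc_generator (rdc_sub F_rdc d) (a := successor m' a)); rewrite size_successor.
Qed.

(** Every [m]-successor with [m > 0] keeps the digit [d], so its generator lies in [F [:: d]] and
    cannot divide [x]; density provides the [0]-successor. *)
Lemma maximal_successor_switch d x a : F [::] x -> x <> 1 ->
  perp (F [::]) x (F [:: d]) -> size a = n ->
  maximal_successor n.+1 g x (d :: a) (~~ d :: nseq n d1).
Proof.
move=> Nx xn1 xd an; exists 0%N; split=> //; first by rewrite /successor /= an.
  exact: rdc_perp_rdivides F_rdc _ _ Nx xd xn1.
case=> // m' m'n gx; have sz : size (successor m' a) = n by rewrite size_successor.
have Fg := rdc_generator (rdc_sub F_rdc d) sz; exfalso.
apply: (rdc_generator_neq1 (rdc_sub F_rdc d) sz); apply: xd => //.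
apply/rdividesT => //; first exact: rdc_Garside F_rdc.
by have [_ FN _ _] := rdc_closed F_rdc d; exact: FN.
Qed.

Lemma greedy_run_lift d y z a L : F [:: d] y -> F [::] z ->
  perp (F [::]) z (F [:: d]) -> size a = n ->
  greedy_run n (fun a => g (d :: a)) y a L 1 ->
  greedy_run n.+1 g (z * y) (d :: a) (map (cons d) L) z.
Proof.
move=> + Nz zd; elim: L y a => [|b L IH] y a Py an /=; first by move=> ->; rewrite mulg1.
move=> [yb [y' yE run]]; split; first exact: maximal_successor_lift.
have bn : size b = n by rewrite (size_maximal_successor yb).
exists (z * y'); first by rewrite yE mulgA.
apply: IH => //; have gd := rdc_sub F_rdc d.
by apply: rel_quotient (rdc_Garside gd) _ _ _ (rdc_generator gd bn); rewrite -yE.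
Qed.

(** The generator at [nseq n d1] divides [y], so the run of [y] begins with the [n]-successor, which
    is [nseq n d1] itself. Starting from [d :: a], the same letter is reached as the [0]-successor,
    and from then on the lifted run applies. *)
Lemma greedy_run_switch d y z a L : F [:: ~~ d] y -> F [::] z ->
  perp (F [::]) z (F [:: ~~ d]) -> perp (F [::]) (z * y) (F [:: d]) ->
  z * y <> 1 -> size a = n ->
  greedy_run n (fun a => g (~~ d :: a)) y (nseq n d1) L 1 -> L <> [::] ->
  greedy_run n.+1 g (z * y) (d :: a) (map (cons (~~ d)) L) z.
Proof.
move=> Py Nz zd zyd zy1 an; case: L => // b L run _.
have [_ NM] := rel_submonoid (rdc_Garside F_rdc).
have [_ FN _ _] := rdc_closed F_rdc (~~ d).
have Nzy : F [::] (z * y) by apply: NM => //; exact: FN.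
have gy : rdivides setT (g (~~ d :: nseq n d1)) y.
  apply: perp_rdivides (rdc_Garside F_rdc) (rdc_closed F_rdc _) Nz Py zd _ _.
    by apply: (rdc_generator (rdc_sub F_rdc _) (a := nseq n d1)); rewrite size_nseq.
  exact: rdc_perp_rdivides F_rdc _ _ Nzy zyd zy1.
have bE : b = nseq n d1.
  case: run => [[m [mn -> _ mmax]] _].
  have succ_n : successor n (nseq n d1) = nseq n d1.
    by rewrite /successor take_oversize ?drop_oversize ?size_nseq ?cats0.
  have -> : m = n by apply/eqP; rewrite eqn_leq mn mmax // succ_n.
  exact: succ_n.
have := greedy_run_lift Py Nz zd (size_nseq n d1) run.
rewrite /= bE => -[_ run']; split=> //.
exact: maximal_successor_switch.
Qed.

End Steps.

(** * Sequences numbered from the right *)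

Lemma entry_rcons1 (T : Type) (x0 y : T) s : entry x0 (rcons s y) 1 = y.
Proof. by rewrite /entry size_rcons subn1 nth_rcons ltnn eqxx. Qed.

Lemma entry_rconsS (T : Type) (x0 y : T) s r : (0 < r <= size s)%N ->
  entry x0 (rcons s y) r.+1 = entry x0 s r.
Proof.
move=> /andP[r0 rs]; rewrite /entry size_rcons subSS nth_rcons.
by rewrite ltn_subrL r0 (leq_trans r0 rs).
Qed.

Lemma take_rconsS (T : Type) (y : T) s r :
  take (size (rcons s y) - r.+1) (rcons s y) = take (size s - r) s.
Proof. by rewrite size_rcons subSS -cats1 takel_cat ?leq_subr. Qed.

Lemma word_prod_rcons (s : seq M) y : word_prod (rcons s y) = word_prod s * y.
Proof. by rewrite /word_prod -cats1 big_cat big_seq1. Qed.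

Lemma word_prod_neq1 (s : seq M) : (0 < size s)%N -> entry 1 s (size s) <> 1 ->
  word_prod s <> 1.
Proof.
by case: s => // y s _; rewrite /entry subnn /word_prod big_cons => y1 /mulg_eq1_l.
Qed.

(** The exceptional decomposition [[:: 1]] of [1] fits the general pattern once the leftmost entry
    is required to be nontrivial only in length at least [2]. *)
Lemma decompositionE N M2 M1 x (s : seq M) : M1 1 ->
  decomposition N M2 M1 x s <->
  [/\ (0 < size s)%N, x = word_prod s, ((1 < size s)%N -> entry 1 s (size s) <> 1) &
      forall r, (1 <= r <= size s)%N ->
        let Mr := if parity_digit r then M2 else M1 in
        Mr (entry 1 s r) /\ perp N (word_prod (take (size s - r) s)) Mr].
Proof.
move=> M1_1; split=> [[[-> ->]|[xn1 xE sn1 sP]]|[s0 xE sn1 sP]].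
- split=> //; first by rewrite /word_prod big_seq1.
  by case=> [|[|r]] //= _; rewrite /word_prod big_nil; split=> //; exact: perp1.
- by split=> //; case: (s) xE xn1 => // ->; rewrite /word_prod big_nil.
have [x1|/eqP xn1] := eqVneq x 1; [left | right].
  split=> //; have [s1|s1] := leqP (size s) 1; last first.
    by case: (word_prod_neq1 s0 (sn1 s1)); rewrite -xE.
  by case: (s) s0 s1 xE => [|y []] // _ _; rewrite x1 /word_prod big_seq1 => <-.
split=> //; have [s1|/sn1 //] := leqP (size s) 1.
by case: (s) s0 s1 xE => [|y []] // _ _; rewrite /entry /word_prod big_seq1 => <-.
Qed.

Lemma parity_digitS r : parity_digit r.+1 = ~~ parity_digit r.
Proof. by rewrite /parity_digit /=; case: odd. Qed.

(** * The decomposition unfolded from its rightmost entry *)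

Section Unfolding.

Variables (n : nat) (F : seq bool -> set M).
Implicit Types (d : bool) (t : seq (nested M n)).

(* [ts] lists the entries of an M-decomposition from right to left, starting
   with the digit [d]. *)
Fixpoint unfolding d (ts : seq (nested M n)) x : Prop :=
  if ts is t :: ts' then exists y z,
    [/\ x = z * y, F [:: d] y, perp (F [::]) z (F [:: d]),
        M_decomposition (fun a => F (d :: a)) y t &
        (ts' <> [::] -> z <> 1) /\ unfolding (~~ d) ts' z]
  else x = 1.

(** Since [d1] is [false], the digits [d (+) parity_digit r] alternate and start with [d] at
    [r = 1]. Both values of [d] occur, because removing the rightmost entry exchanges the digits. *)
Let alternating d t x (s : seq M) :=
  [/\ size t = size s, x = word_prod s,
      ((1 < size s)%N -> entry 1 s (size s) <> 1) &
      forall r, (1 <= r <= size s)%N -> let e := d (+) parity_digit r in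
        [/\ F [:: e] (entry 1 s r),
            perp (F [::]) (word_prod (take (size s - r) s)) (F [:: e]) &
            M_decomposition (fun a => F (e :: a)) (entry 1 s r)
              (entry (nested0 M n) t r)]].

Lemma unfolding_rev d t x :
  unfolding d (rev t) x <-> exists s : seq M, alternating d t x s.
Proof.
elim/last_ind: t d x => [|t u IH] d x.
  split=> [->|[s [/esym/size0nil s0 -> _ _]]]; last by rewrite s0 /word_prod big_nil.
  by exists [::]; split; rewrite ?/word_prod ?big_nil // => -[|r].
rewrite rev_rcons /=; split.
  move=> [y [z [xE Py zd uy [zn1 /IH[s [st zE sn1 sP]]]]]].
  exists (rcons s y); split; first by rewrite !size_rcons st.
  - by rewrite word_prod_rcons -zE.
  - rewrite size_rcons ltnS => s0; rewrite entry_rconsS ?s0 //=.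
    (* If [s] has a single entry, that entry is [z], and its nontriviality comes from [zn1], not
       from [sn1]. *)
    case: (s) st zE sn1 s0 => [//|y' [|y'' s']] st zE sn1 _ /=; last exact: sn1.
    rewrite /entry /= => y'1; apply: zn1; last by rewrite zE /word_prod big_seq1.
    by move=> /(congr1 size); rewrite size_rev st.
  case=> [//|[_|r]]; last first.
    move=> rs; rewrite parity_digitS addbN -addNb take_rconsS.
    move: rs; rewrite size_rcons /= ltnS => rs.
    by rewrite !entry_rconsS ?st //; exact: sP.
  rewrite take_rconsS subn0 take_size -zE /= /parity_digit /= addbF.
  by rewrite !entry_rcons1.
move=> [s]; case/lastP: s => [|s y] []; first by rewrite size_rcons.
rewrite !size_rcons word_prod_rcons => -[st] xE sn1 sP.
have sn1' : (0 < size s)%N -> entry 1 s (size s) <> 1.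
  by move=> s0; have := sn1 s0; rewrite entry_rconsS ?s0 /=.
exists y, (word_prod s); have [] := sP 1%N (ltn0Sn _).
rewrite -(size_rcons s y) take_rconsS subn0 take_size /parity_digit /= addbF.
rewrite !entry_rcons1 => Py sd uy; split=> //; split.
  move=> t0; have s0 : (0 < size s)%N by rewrite -st -size_rev; case: rev t0.
  by apply: word_prod_neq1 => //; exact: sn1'.
apply/IH; exists s; split=> //; first by move=> /ltnW.
move=> r rs; have := sP r.+1; rewrite /= ltnS => /(_ (proj2 (andP rs))).
rewrite -(size_rcons s y) take_rconsS !entry_rconsS ?st //.
by rewrite parity_digitS addbN -addNb.
Qed.

Lemma unfolding_mem d t x : submonoid (F [::]) ->
  (forall e, F [:: e] `<=` F [::]) -> unfolding d t x -> F [::] x.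
Proof.
move=> [N1 NM] FN; elim: t d x => [|t ts IH] d x /= => [->//|].
by move=> [y [z [-> Py _ _ [_ /IH]]]] Nz; apply: NM => //; exact: FN Py.
Qed.

End Unfolding.

Lemma M_decompositionE n (F : seq bool -> set M) x (t : nested M n.+1) :
  F [:: d1] 1 -> M_decomposition F x t <->
  t <> [::] :> seq (nested M n) /\ unfolding F d1 (rev t) x.
Proof.
move=> F1; split.
  move=> [s [/(decompositionE _ _ _ _ F1)[s0 xE sn1 sP] ts tP]]; split.
    by move=> t0; rewrite -ts t0 in s0.
  apply/unfolding_rev; exists s; split=> // r rs; rewrite addFb.
  have [Py sy] := sP r rs; have ty := tP r rs.
  by case: parity_digit Py sy ty.
move=> [t0 /unfolding_rev[s [ts xE sn1 sP]]]; exists s; split=> //.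
  apply/decompositionE => //; split=> //.
    by rewrite -ts; case: (t : seq _) t0.
  move=> r rs; have := sP r rs; rewrite addFb.
  by case: parity_digit => -[].
by move=> r rs; have [] := sP r rs.
Qed.

(** * Existence and uniqueness of the decomposition *)

Section Existence.

Variables (n : nat) (F : seq bool -> set M) (g : seq bool -> M).
Hypothesis F_rdc : relative_dense_covering n.+1 F g.
Hypothesis sub_decomposition : forall d y, F [:: d] y ->
  exists! t : nested M n, M_decomposition (fun a => F (d :: a)) y t.

Let N_Garside := rdc_Garside F_rdc.

Lemma rdc_covering_neq1 d x : F [::] x -> x <> 1 ->
  perp (F [::]) x (F [:: d]) -> ~ perp (F [::]) x (F [:: ~~ d]).
Proof.
move=> Nx xn1 xd xd'; apply: xn1.
have [_ _ NE] := rdc_covering F_rdc (a := [::]) (ltn0Sn n).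
apply: (perp_generated (rel_submonoid N_Garside) (esym NE) Nx).
  by case: d xd xd'.
by case: d xd xd'.
Qed.

(** As [x] is perpendicular to the other factor, a nontrivial [x] has a nontrivial tail [y]; hence
    [lam] drops from [x] to [z]. *)
Lemma unfolding_exists d x : F [::] x -> perp (F [::]) x (F [:: ~~ d]) ->
  exists2 ts : seq (nested M n), unfolding F d ts x & x = 1 -> ts = [::].
Proof.
have [k] := ubnP (lam x); elim: k d x => // k IH d x; rewrite ltnS => ltx Nx xd.
have [->|/eqP xn1] := eqVneq x 1; first by exists [::].
have [y [z [Py Nz xE zd]]] := tail_exists N_Garside (rdc_closed F_rdc d) Nx.
have yn1 : y <> 1.
  move=> y1; apply: (rdc_covering_neq1 Nx xn1 xd).
  by rewrite negbK xE y1 mulg1.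
have [||t tz t0] := IH (~~ d) z _ Nz.
- by apply: leq_trans ltx; rewrite xE; exact: lam_ltMl.
- by rewrite negbK.
have [u [uy _]] := sub_decomposition Py.
exists (u :: t) => //; exists y, z; split=> //; split=> // + z1.
by rewrite t0.
Qed.

(** The rightmost entry is treated apart, since it alone may be trivial. *)
Lemma unfolding_cons_exists d x : F [::] x ->
  exists t (ts : seq (nested M n)), unfolding F d (t :: ts) x.
Proof.
move=> Nx.
have [y [z [Py Nz xE zd]]] := tail_exists N_Garside (rdc_closed F_rdc d) Nx.
have [|t tz t0] := @unfolding_exists (~~ d) z Nz; first by rewrite negbK.
have [u [uy _]] := sub_decomposition Py.
by exists u, t, y, z; split=> //; split=> // + z1; rewrite t0.
Qed.

Lemma unfolding_unique d (ts ts' : seq (nested M n)) x : (ts = [::] <-> ts' = [::]) ->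
  unfolding F d ts x -> unfolding F d ts' x -> ts = ts'.
Proof.
have FN e : F [:: e] `<=` F [::] by have [] := rdc_closed F_rdc e.
have mem e := @unfolding_mem n F e _ _ (rel_submonoid N_Garside) FN.
elim: ts ts' d x => [|t ts IH] [|t' ts'] d x [E1 E2] //.
- by have := E1 erefl.
- by have := E2 erefl.
move=> [y [z [xE Py zd ty [tz uz]]]] [y' [z' [xE' Py' zd' ty' [tz' uz']]]].
have [yy zz] := tail_unique N_Garside (rdc_closed F_rdc d) Py (mem _ _ _ uz) zd
  Py' (mem _ _ _ uz') zd' (etrans (esym xE) xE').
rewrite -{}yy -{}zz in ty' tz' uz'.
have [u [_ uP]] := sub_decomposition Py.
rewrite -(uP _ ty) (uP _ ty'); congr (_ :: _); apply: (IH _ _ _ _ uz uz').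
split=> [t0|t0]; apply: contrapT.
  by move=> /tz'; apply; rewrite t0 in uz.
by move=> /tz; apply; rewrite t0 in uz'.
Qed.

End Existence.

Lemma M_decomposition_exists_unique n F g x : relative_dense_covering n F g ->
  F [::] x -> exists! t : nested M n, M_decomposition F x t.
Proof.
elim: n F g x => [|n IH] F g x rF Nx; first by exists x; split=> // t ->.
have F1 : F [:: d1] 1.
  by have [[]] := rdc_closed rF d1.
have subD d y : F [:: d] y -> exists! t : nested M n,
    M_decomposition (fun a => F (d :: a)) y t.
  exact: IH (rdc_sub rF d).
have [t [ts tx]] := unfolding_cons_exists rF subD d1 Nx.
exists (rev (t :: ts)); split.
  apply/M_decompositionE => //; rewrite revK; split=> //.
  by move/(congr1 size); rewrite size_rev.
move=> t' /(M_decompositionE _ _ F1)[t'0 tx'].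
rewrite (unfolding_unique rF subD _ tx tx') ?revK //.
by split=> // /(congr1 size); rewrite size_rev => /size0nil.
Qed.

(** * The decomposition read as a greedy run *)

Fixpoint addressed_unfolding n d (ts : seq (nested M n)) : seq (seq bool * M) :=
  if ts is t :: ts' then addressed_unfolding (~~ d) ts' ++
    [seq (d :: p.1, p.2) | p <- addressed_entries [::] t]
  else [::].

Lemma addressed_entries_cat n b (t : nested M n) :
  addressed_entries b t = [seq (b ++ p.1, p.2) | p <- addressed_entries [::] t].
Proof.
elim: n b t => [|n IH] b t /=; first by rewrite cats0.
rewrite map_flatten -map_comp; congr flatten; apply: eq_map => r /=.
rewrite IH [in RHS]IH -map_comp; apply: eq_map => p /=.
by rewrite cat_rcons.
Qed.

Lemma addressed_entries_rev n (t : nested M n.+1) :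
  addressed_entries [::] t = addressed_unfolding d1 (rev t).
Proof.
suff H d : flatten [seq addressed_entries [:: d (+) parity_digit r]
    (entry (nested0 M n) t r) | r <- rev (iota 1 (size t))] =
    addressed_unfolding d (rev t) by rewrite -H.
elim/last_ind: t d => [//|t u IH] d; rewrite rev_rcons /= -IH size_rcons /=.
rewrite rev_cons map_rcons flatten_rcons entry_rcons1 addressed_entries_cat.
rewrite addbF; congr (flatten _ ++ _).
rewrite (iotaDl 1 1) -map_rev -map_comp; apply/eq_in_map => r.
rewrite mem_rev mem_iota add1n ltnS => rt /=.
by rewrite entry_rconsS // parity_digitS addbN -addNb.
Qed.

Definition powers (g : seq bool -> M) (es : seq (seq bool * nat)) :=
  [seq (p.1, g p.1 ^+ p.2) | p <- es].

(** Addresses are kept instead of letters, because the next greedy step depends on the address. *)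
Definition expand (es : seq (seq bool * nat)) := flatten [seq nseq p.2 p.1 | p <- es].

Definition prefixed d (es : seq (seq bool * nat)) := [seq (d :: p.1, p.2) | p <- es].

Lemma expand_cat es1 es2 : expand (es1 ++ es2) = expand es1 ++ expand es2.
Proof. by rewrite /expand map_cat flatten_cat. Qed.

Lemma expand_prefixed d es : expand (prefixed d es) = map (cons d) (expand es).
Proof.
rewrite /expand map_flatten -!map_comp; congr flatten; apply: eq_map => p /=.
by rewrite map_nseq.
Qed.

Lemma powers_prefixed g d es : powers g (prefixed d es) =
  [seq (d :: p.1, p.2) | p <- powers (fun a => g (d :: a)) es].
Proof. by rewrite /powers -!map_comp. Qed.

Lemma all_prefixed d es : all (fun p => 0 < p.2)%N (prefixed d es) =
  all (fun p => 0 < p.2)%N es.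
Proof. by rewrite all_map. Qed.

(** A final [1] is tied to the failure of the first generator to divide [x]. This is how trivial
    entries get excluded everywhere except at the right end. *)
Definition greedy_reading n g x (s : seq (seq bool * M)) :=
  exists es : seq (seq bool * nat),
  [/\ all (fun p => 0 < p.2)%N es,
      s = powers g es \/ (~ rdivides setT (g (nseq n d1)) x /\
        exists a, s = rcons (powers g es) (a, 1)) &
      greedy_run n g x (nseq n d1) (rev (expand es)) 1].

Section Reading.

Variables (n : nat) (F : seq bool -> set M) (g : seq bool -> M).
Hypothesis F_rdc : relative_dense_covering n.+1 F g.
Hypothesis sub_reading : forall d y (t : nested M n), F [:: d] y ->
  M_decomposition (fun a => F (d :: a)) y t ->
  greedy_reading n (fun a => g (d :: a)) y (addressed_entries [::] t).

Let N_Garside := rdc_Garside F_rdc.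
Let mem d (ts : seq (nested M n)) x : unfolding F d ts x -> F [::] x.
Proof.
apply: unfolding_mem (rel_submonoid N_Garside) _.
by move=> e; have [] := rdc_closed F_rdc e.
Qed.

(** Only the first digit of the previous address matters, as the run begins with a [0]-successor;
    hence the arbitrary [a]. *)
Lemma unfolding_reading d x (ts : seq (nested M n)) :
  unfolding F d ts x -> perp (F [::]) x (F [:: ~~ d]) -> (ts <> [::] -> x <> 1) ->
  exists es, [/\ all (fun p => 0 < p.2)%N es,
    addressed_unfolding d ts = powers g es &
    forall a, size a = n ->
      greedy_run n.+1 g x (~~ d :: a) (rev (expand es)) 1].
Proof.
elim: ts d x => [|t ts IH] d x; first by move=> -> _ _; exists [::].
move=> tx xd /(_ _)xn1; have {}xn1 : x <> 1 by exact: xn1.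
have Nx := mem tx; case: tx => y [z [xE Py zd ty [tz uz]]].
have [|es [es0 tsE run]] := IH _ _ uz _ tz; first by rewrite negbK.
have [es' [es'0 tE run']] := sub_reading Py ty.
(* Density makes this generator divide [x], and [perp_rdivides] transfers this to [y]; so the
   reading of [y] has no final [1] and its run is nonempty. *)
have gy : rdivides setT (g (d :: nseq n d1)) y.
  apply: perp_rdivides N_Garside (rdc_closed F_rdc d) (mem uz) Py zd _ _.
    by apply: (rdc_generator (rdc_sub F_rdc d) (a := nseq n d1)); rewrite size_nseq.
  rewrite -xE -[d]negbK; exact: rdc_perp_rdivides F_rdc _ _ Nx xd xn1.
case: tE => [tE|[//]].
exists (es ++ prefixed d es'); split.
- by rewrite all_cat es0 all_prefixed.
- by rewrite /= tsE tE /powers map_cat -/(powers _ _) -/(powers _ _) powers_prefixed.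
move=> a an; rewrite expand_cat rev_cat expand_prefixed -map_rev xE.
have gen1 : g (d :: nseq n d1) <> 1.
  by apply: (rdc_generator_neq1 F_rdc); rewrite /= size_nseq.
have rn0 : rev (expand es') <> [::].
  move=> r0; rewrite r0 /= in run'; rewrite run' in gy.
  by case: gy => _ [u _ /esym/mulg_eq1_r].
apply: (greedy_run_cat (y := z)).
  rewrite -[in map _ _](negbK d).
  by apply: (greedy_run_switch F_rdc) => //; rewrite ?negbK // -?xE //; exact: mem uz.
have := greedy_run_size run'; rewrite size_nseq.
case/lastP: (rev _) rn0 => // L b _; rewrite all_rcons => /andP[/eqP bn _].
by rewrite map_rcons last_rcons -{1}[d]negbK; exact: run.
Qed.

Lemma unfolding_cons_reading x t (ts : seq (nested M n)) : unfolding F d1 (t :: ts) x ->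
  greedy_reading n.+1 g x (addressed_unfolding d1 (t :: ts)).
Proof.
move=> tx; have Nx := mem tx; case: tx => y [z [xE Py zd ty [tz uz]]].
have [es [es0 tsE run]] := unfolding_reading uz zd tz.
have [es' [es'0 tE run']] := sub_reading Py ty.
exists (es ++ prefixed d1 es'); split.
- by rewrite all_cat es0 all_prefixed.
- rewrite {1 2}/powers map_cat -!/(powers _ _) powers_prefixed /= tsE.
  case: tE => [->|[gy [a ->]]]; [by left | right; split].
    move=> gx; apply: gy.
    apply: perp_rdivides N_Garside (rdc_closed F_rdc d1) (mem uz) Py zd _ _.
      by apply: (rdc_generator (rdc_sub F_rdc d1) (a := nseq n d1)); rewrite size_nseq.
    by rewrite -xE.
  by exists (d1 :: a); rewrite map_rcons rcons_cat.
rewrite expand_cat rev_cat expand_prefixed -map_rev xE.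
apply: (greedy_run_cat (y := z)).
  by apply: (greedy_run_lift F_rdc) => //; [exact: mem uz | exact: size_nseq].
have := greedy_run_size run'; rewrite size_nseq.
(* If [y] is trivial its run is empty, and the division of [z] switches directly from the initial
   address. *)
case/lastP: (rev _) => [_|L b]; first by rewrite /=; apply: run; exact: size_nseq.
rewrite all_rcons => /andP[/eqP bn _].
by rewrite map_rcons last_rcons; exact: run.
Qed.

End Reading.

Lemma M_decomposition_reading n F g x (t : nested M n) :
  relative_dense_covering n F g -> F [::] x -> M_decomposition F x t ->
  greedy_reading n g x (addressed_entries [::] t).
Proof.
elim: n F g x t => [|n IH] F g x t rF Nx.
  move=> /= ->; move: Nx; rewrite (rdc_atomic rF (erefl : size [::] = 0%N)).2.
  have gn1 : g [::] <> 1 by exact: rdc_generator_neq1 rF _.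
  move=> /generated1[[|e] ->].
    exists [::]; split=> //; right; split; last by exists [::].
    by move=> [_ [z _ /esym/mulg_eq1_r]].
  exists [:: ([::], e.+1)]; split=> //; first by left.
  have -> : rev (expand [:: ([::], e.+1)]) = nseq e.+1 [::].
    by rewrite /expand /= cats0 -[_ :: _]/(nseq e.+1 [::]) rev_nseq.
  (* The empty address is its own only successor, so each step removes one factor [g [::]]. *)
  elim: e.+1 => //= {}e IHe; split; last by exists (g [::] ^+ e); rewrite // expgSr.
  exists 0%N; split=> //.
  by split=> //; exists (g [::] ^+ e); rewrite // expgSr.
have F1 : F [:: d1] 1 by have [[]] := rdc_closed rF d1.
move=> /(M_decompositionE _ _ F1)[t0 tx]; rewrite addressed_entries_rev.
case E: (rev t) tx => [|u ts] tx.
  by case: t0; rewrite -[t]revK E.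
apply: (unfolding_cons_reading rF) tx => d y v Py yv.
exact: IH (rdc_sub rF d) Py yv.
Qed.

(** * Runs translated into greedy addresses and normal words *)

Lemma entry_rev (T : Type) (x0 : T) s k : (k < size s)%N ->
  entry x0 (rev s) k.+1 = nth x0 s k.
Proof.
move=> ks; rewrite /entry size_rev nth_rev ?subnSK ?subKn ?(ltnW ks) //.
exact: leq_subr.
Qed.

Lemma address_at_rev n L k : (k <= size L)%N ->
  address_at n (rev L) k = nth [::] (nseq n d1 :: L) k.
Proof. by case: k => // k kL; rewrite /address_at entry_rev. Qed.

Lemma address_atE n (s : seq (seq bool)) k : (k <= size s)%N ->
  address_at n s k = nth [::] (nseq n d1 :: rev s) k.
Proof. by move=> ks; rewrite -address_at_rev ?revK ?size_rev. Qed.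

Section GreedyAddresses.

Variables (n : nat) (g : seq bool -> M).
Hypothesis g_neq1 : forall a, size a = n -> g a <> 1.
Implicit Types (a b : seq bool) (L : seq (seq bool)).

Lemma greedy_runP x a L z : greedy_run n g x a L z <->
  exists xs : nat -> M, [/\ xs 0%N = x, xs (size L) = z & forall k, (k < size L)%N ->
    maximal_successor n g (xs k) (nth [::] (a :: L) k) (nth [::] L k) /\
    xs k = xs k.+1 * g (nth [::] L k)].
Proof.
elim: L x a => [|b L IH] x a /=.
  by split=> [->|[xs [<- <-]] //]; exists (fun=> z).
split=> [[xb [x' xE /IH[xs [xs0 xsz xsP]]]]|[xs [xs0 xsz xsP]]].
  exists (fun k => if k is k'.+1 then xs k' else x); split=> // -[_|k kL] /=.
    by rewrite xs0.
  exact: xsP.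
have [xb xE] := xsP 0%N (ltn0Sn _); rewrite xs0 in xb xE.
split=> //; exists (xs 1%N) => //; apply/IH; exists (fun k => xs k.+1); split=> //.
by move=> k kL; exact: (xsP k.+1).
Qed.

Lemma greedy_addressesP x s : greedy_addresses n g x s <->
  greedy_run n g x (nseq n d1) (rev s) 1.
Proof.
rewrite -{1}[s]revK; move: (rev s) => L; split.
  move=> [xs [xs0 xsz xsP]]; apply/greedy_runP; exists xs; rewrite size_rev in xsz xsP.
  split=> // k kL; have [_] := xsP k.+1 kL.
  by rewrite !address_at_rev // ltnW.
move=> run; have /allP szL := greedy_run_size run; move: run.
move=> /greedy_runP[xs [xs0 xsz xsP]]; exists xs; rewrite size_rev; split=> //.
case=> // k kL; have [mk xk] := xsP k kL; rewrite !address_at_rev ?(ltnW kL) //.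
(* A remainder with a nontrivial right divisor is itself nontrivial. *)
split=> //; apply: (maximal_successor_neq1 _ mk); apply: g_neq1.
by have /szL/eqP-> := mem_nth [::] kL; rewrite size_nseq.
Qed.

Lemma normal_wordP x (w : seq M) :
  (forall a, size a = n -> atom (g a)) ->
  word_prod w = x /\ normal_word n g w <->
  exists2 s, w = map g s & greedy_run n g x (nseq n d1) (rev s) 1.
Proof.
move=> g_atom; split.
  move=> [wx [_ [s [sw _ sP]]]].
  have wE : w = map g s.
    apply: (@eq_from_nth _ 1) => [|i iw]; first by rewrite size_map.
    have kw : (0 < size w - i <= size w)%N by rewrite subn_gt0 iw leq_subr.
    have [+ _] := sP _ kw; rewrite /entry subKn ?(ltnW iw) // => ->.
    rewrite (nth_map [::]) ?sw //; congr g.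
    case: (size w - i)%N kw (subKn (ltnW iw)) => //= j _ <-.
    by rewrite /entry sw.
  exists s => //; apply/greedy_runP.
  (* The remainder after [k] divisions is the product of [w] without its [k] rightmost letters. *)
  exists (fun k => word_prod (take (size w - k) w)).
  rewrite subn0 take_size size_rev sw subnn take0; split=> //.
    by rewrite /word_prod big_nil.
  move=> k ks; have [wk] := sP k.+1 ks.
  rewrite subnSK // !address_atE ?sw ?(ltnW ks) //.
  move=> mk; split=> //; rewrite -(subnSK ks) (take_nth 1) ?word_prod_rcons.
    by congr (_ * _); rewrite address_atE ?sw in wk.
  by rewrite ltn_subrL /= (leq_ltn_trans _ ks).
move=> [s wE run]; have /allP szL := greedy_run_size run.
have {}szL b : b \in s -> size b = n.
  by move=> bs; rewrite (eqP (szL b _)) ?mem_rev ?size_nseq.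
move: run => /greedy_runP[xs [xs0 xsz xsP]]; rewrite size_rev in xsz xsP.
have sw : size s = size w by rewrite wE size_map.
have nth_rev_s k : (k < size s)%N -> nth [::] (rev s) k = entry [::] s k.+1.
  by move=> ks; rewrite -[in RHS](revK s) entry_rev ?size_rev.
have entry_w k : (k < size s)%N -> entry 1 w k.+1 = g (nth [::] (rev s) k).
  move=> ks; rewrite nth_rev_s // /entry -sw wE (nth_map [::]) //.
  by rewrite ltn_subrL /= (leq_ltn_trans _ ks).
(* The induction starts at the left end of the word, where the remainder is [1], and undoes one
   division per letter. *)
have wordE j : (j <= size s)%N -> word_prod (take j w) = xs (size s - j)%N.
  elim: j => [|j IH] js; first by rewrite take0 subn0 xsz /word_prod big_nil.
  have ks : (size s - j.+1 < size s)%N by rewrite ltn_subrL /= (leq_ltn_trans _ js).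
  rewrite (take_nth 1) -?sw // word_prod_rcons IH ?(ltnW js) //.
  have [_ ->] := xsP _ ks; rewrite subnSK // -entry_w // /entry -sw.
  by rewrite subnSK // subKn // (ltnW js).
split.
  by rewrite -(take_size w) -sw wordE // subnn.
split; first by move=> y; rewrite wE => /mapP[b /szL/g_atom ? ->].
exists s; split=> //; first by apply/allP => b /szL ->.
case=> // k ks; rewrite -sw in ks *; have [mk _] := xsP k ks.
rewrite entry_w // !address_atE ?(ltnW ks) //; split=> //.
by rewrite subnSK // wordE ?leq_subr // subKn ?(ltnW ks).
Qed.

End GreedyAddresses.

End GarsideMonoid.

Theorem proposition3p6 (M : monoidType) (n : nat)
    (F : seq bool -> set M) (g : seq bool -> M)
    (M_Garside : locally_right_Garside M)
    (M_C3plus : cond_C3plus M)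
    (F_covering : n_covering n F)
    (F_atomic : atomic_covering n F g)
    (F_dense : dense_covering n F)
    (x : M) :
  exists w : seq M,
    [/\ word_prod w = x /\ normal_word n g w,
        forall w' : seq M, word_prod w' = x -> normal_word n g w' -> w' = w,
        exists a : seq (seq bool),
          [/\ greedy_addresses n g x a,
              forall a', greedy_addresses n g x a' -> a' = a &
              w = [seq g b | b <- a]]
      & exists t : nested M n,
          [/\ M_decomposition F x t,
              forall t', M_decomposition F x t' -> t' = t &
              concatenates_to g (addressed_entries [::] t) w]].
Proof.
case: M_Garside => cancel lcm _; case: M_C3plus => lam lamP.
case: F_covering => F0 F_cov.
have rF : relative_dense_covering n F g.
  split=> //; rewrite F0; split=> // y z t yt zt; apply: lcm; by exists t.
have g1 a : size a = n -> g a <> 1%g by exact: rdc_generator_neq1 rF.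
have g_atom a : size a = n -> atom (g a) by move=> /F_atomic[].
have Nx : F [::] x by rewrite F0.
have [t [tx t_uniq]] := M_decomposition_exists_unique cancel lamP rF Nx.
have [es [es0 tE run]] := M_decomposition_reading cancel lamP rF Nx tx.
(* Normal words and greedy addresses both amount to such runs, so this one statement yields both
   uniqueness claims. *)
have unique s : greedy_run n g x (nseq n d1) (rev s) 1%g -> s = expand es.
  move=> run'; apply: (can_inj revK).
  exact: (greedy_run_unique cancel lamP g1 (size_nseq n d1) run' run).
exists (map g (expand es)); split.
- by apply/(normal_wordP _ _ g_atom); exists (expand es).
- move=> w wx w_normal.
  have [|s -> /unique -> //] := (normal_wordP x w g_atom).1.
  by split.
- exists (expand es); split=> //; first exact/(greedy_addressesP lamP g1).
  by move=> s /(greedy_addressesP lamP g1)/unique.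
exists t; split=> //; first by move=> t' /t_uniq.
exists es; split=> //; first by case: tE => [|[_]]; [left|right].
rewrite /expand map_flatten -map_comp; congr flatten.
by apply: eq_map => p /=; rewrite map_nseq.
Qed.
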